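(* Let $n\ge1$. There exist $a\in\{0,1,2,3,4\}$ and $b\in\{0,1,\dots,2n\}$ such that the code \[\mathcal{C}_2(n)=\left\{\boldsymbol{x}\in\mathbb{Z}_2^n:\ r^{(1)}(\boldsymbol{x})\equiv a \pmod 5 \ \text{ and }\ \sum_{i=1}^{r(\boldsymbol{x})} i\,r_i(\boldsymbol{x})\equiv b \pmod{2n+1}\right\}\] satisfies \[|\mathcal{C}_2(n)|\ge\frac{2^n}{5(2n+1)}.\]
   Context: For a word $\boldsymbol{x}$, a run is a maximal block of consecutive equal symbols; $r(\boldsymbol{x})$ is the number of runs, $r_i(\boldsymbol{x})$ the length of the $i$-th run (from left to right), and $r^{(1)}(\boldsymbol{x})$ the number of runs of length exactly $1$. *)

(* Defs.v *)
From mathcomp Require Import all_boot all_order all_algebra.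
Set Implicit Arguments.
Unset Strict Implicit.
Unset Printing Implicit Defensive.

Section Runs.
Variable T : eqType.
Implicit Types (s : seq T) (x : T).

(* The runs of a word, from left to right, each as a block of symbols.
   [runsP] and [runs_unique] below show that this is the unique decomposition
   into maximal constant blocks. *)
Fixpoint runs s : seq (seq T) :=
  if s is x :: s' then
    match runs s' with
    | (y :: t) :: bs =>
        if x == y then (x :: y :: t) :: bs else [:: x] :: (y :: t) :: bs
    | bs => [:: x] :: bs
    end
  else [::].

Definition num_runs s : nat := size (runs s).

(* Runs are numbered from 1; the value is 0 when i is not in [1, num_runs s]. *)
Definition run_length s (i : nat) : nat :=
  if i is j.+1 then size (nth [::] (runs s) j) else 0.

Definition num_unit_runs s : nat := count (fun t => size t == 1) (runs s).

(* A block decomposition is maximal when neighbouring blocks end and begin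
   with different symbols. *)
Definition blocks_differ : rel (seq T) :=
  fun t u => if t is x :: t' then if u is y :: _ then last x t' != y
    else false else false.

Definition run_decomposition s (bs : seq (seq T)) : bool :=
  [&& flatten bs == s, all (fun t => (t != [::]) && constant t) bs
    & sorted blocks_differ bs].

Lemma runsP s : run_decomposition s (runs s).
Proof.
elim: s => [//|x s /and3P[/eqP fl al so]] /=.
case: (runs s) fl al so => [|[|y t] bs] //=; first by move=> <- _ _; rewrite /run_decomposition /= eqxx.
move=> <- /andP[ct al] so; rewrite /run_decomposition.
case: (eqVneq x y) => [-> | xy] /=; last by rewrite eqxx al ct xy so.
rewrite eqxx al eqxx /= ct /=.
by case: bs so {al} => [|[|z u] bs].
Qed.

Lemma runs_unique s bs : run_decomposition s bs -> bs = runs s.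
Proof.
case/and3P=> /eqP <- {s}; elim: bs => [//|b bs IH] /= /andP[/andP[b0 cb] al] so.
have {}IH := IH al (path_sorted so).
elim: b b0 cb so => [//|x [|y t] IHb] _ /=.
  move=> _ so; rewrite -IH.
  by case: bs so al {IH IHb} => [//|[|z u] bs] //= /andP[/negPf -> _] _.
case/andP=> /eqP yx ct so; subst y.
have {}so : path blocks_differ (x :: t) bs by case: bs so {al IH IHb}.
by have /= <- := IHb isT ct so; rewrite eqxx.
Qed.

End Runs.

Definition code2 (n a b : nat) : {set n.-tuple 'Z_2} :=
  [set x : n.-tuple 'Z_2 |
     (num_unit_runs x == a %[mod 5]) &&
     (\sum_(1 <= i < (num_runs x).+1) i * run_length x i == b %[mod 2 * n + 1])].

(* Main.v *)
Require Import Defs.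
From mathcomp Require Import all_boot all_order all_algebra.
Import Order.TTheory GRing.Theory Num.Theory.
Local Open Scope ring_scope.

(** The two residues sort the 2^n binary words into 5(2n+1) classes, and each class is one of the
    codes. By averaging ([pigeonhole_fiber]), some class has at least 2^n / (5(2n+1)) words. *)

Lemma pigeonhole_fiber {T rT : finType} (y0 : rT) (f : T -> rT) :
  exists y : rT, (#|T| <= #|rT| * #|[set x | f x == y]|)%N.
Proof.
(* A largest fibre works: the fibres partition [T], and none exceeds it. The point [y0] witnesses
   that [rT] is inhabited, so a maximum exists. *)
have [y _ ymax] := arg_maxnP (fun y => #|[set x | f x == y]|) (erefl (predT y0)).
exists y; rewrite -[X in (X <= _)%N]sum1_card (partition_big f predT) //=.
rewrite -sum_nat_const; apply: leq_sum => z _.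
by rewrite sum1_card; apply: leq_trans (ymax z isT); rewrite cardsE.
Qed.

Theorem corollary2 (n : nat) (hn : (1 <= n)%N) :
  exists (a : 'I_5) (b : 'I_(2 * n + 1)),
    (2 ^+ n / (5 * (2 * n%:R + 1)) : rat) <= #|code2 n a b|%:R.
Proof.
have m_gt0 : (0 < 2 * n + 1)%N by rewrite addn1.
pose weight (x : n.-tuple 'Z_2) :=
  (\sum_(1 <= i < (num_runs x).+1) i * run_length x i)%N.
pose residues (x : n.-tuple 'Z_2) : 'I_5 * 'I_(2 * n + 1) :=
  (Ordinal (ltn_pmod (num_unit_runs x) (isT : 0 < 5)%N),
   Ordinal (ltn_pmod (weight x) m_gt0)).
have [[a b]] := pigeonhole_fiber (ord0, Ordinal m_gt0) residues.
(* Since [a] and [b] are already reduced, equality of residues is exactly the pair of congruences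
   defining the code. *)
have -> : [set x | residues x == (a, b)] = code2 n a b.
  apply/setP => x; rewrite !inE xpair_eqE -!val_eqE /=.
  by rewrite (modn_small (ltn_ord a)) (modn_small (ltn_ord b)).
rewrite card_tuple card_prod !card_ord => le_card; exists a, b.
(* With the denominator a cast natural number, the rational bound becomes [le_card]. *)
have -> : 5 * (2 * n%:R + 1) = (5 * (2 * n + 1))%:R :> rat.
  by rewrite natrM natrD natrM.
rewrite ler_pdivrMr ?ltr0n ?muln_gt0 //.
by rewrite -natrX -natrM ler_nat mulnC.
Qed.
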